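(* Let $b>a>0$, $q\ge1$, and let $m,\ell\in\mathbb{R}$ with $m>0$ and $m\ge2\ell\ge0$. Then $$\left|\frac{2\ell\ln G(a,b)+(m-2\ell)\ln A(a,b)}m-\ln I(a,b)\right|\le\frac{b-a}{4m}\left[\frac1{2m^2(q+1)(q+2)}\right]^{1/q}$$ $$\times\left\{\left[\frac{(2\ell)^{q+2}+(mq+m+2\ell)(m-2\ell)^{q+1}}{a^q}+\frac{(mq+3m-2\ell)(m-2\ell)^{q+1}+(2mq+4m-2\ell)(2\ell)^{q+1}}{b^q}\right]^{1/q}\right.$$ $$\left.+\left[\frac{(2mq+4m-2\ell)(2\ell)^{q+1}+(mq+3m-2\ell)(m-2\ell)^{q+1}}{a^q}+\frac{(2\ell)^{q+2}+(mq+m+2\ell)(m-2\ell)^{q+1}}{b^q}\right]^{1/q}\right\}$$ and $$\left|\frac{2\ell\ln G(a,b)+(m-2\ell)\ln A(a,b)}m-\ln I(a,b)\right|\le\frac{b-a}{8m^2}\left(\frac1{3m}\right)^{1/q}\big[(m-2\ell)^2+(2\ell)^2\big]^{1-1/q}$$ $$\times\left\{\left[\frac{4\ell^3+(m+\ell)(m-2\ell)^2}{a^q}+\frac{(2m-\ell)(m-2\ell)^2+4(3m-\ell)\ell^2}{b^q}\right]^{1/q}+\left[\frac{4(3m-\ell)\ell^2+(2m-\ell)(m-2\ell)^2}{a^q}+\frac{4\ell^3+(m+\ell)(m-2\ell)^2}{b^q}\right]^{1/q}\right\}.$$ In particular, $$\left|\frac{2\ell\ln G(a,b)+(m-2\ell)\ln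 A(a,b)}m-\ln I(a,b)\right|\le\frac{b-a}{4m^2}\cdot\frac{4\ell^2+(m-2\ell)^2}{H(a,b)}.$$
   Context: For positive numbers $a,b$: $A(a,b)=\frac{a+b}2$; $G(a,b)=\sqrt{ab}$; $H(a,b)=\frac{2ab}{a+b}$; $I(a,b)=\frac1e\left(\frac{b^b}{a^a}\right)^{1/(b-a)}$ if $a\ne b$ and $I(a,a)=a$. *)

(* Defs.v *)
From mathcomp Require Import all_boot all_order all_algebra.
From mathcomp Require Import all_classical all_reals all_analysis.

Set Implicit Arguments.
Unset Strict Implicit.
Unset Printing Implicit Defensive.

Import Order.TTheory GRing.Theory Num.Theory.

Local Open Scope ring_scope.

Definition arith_mean (R : realType) (a b : R) : R := (a + b) / 2.

Definition geom_mean (R : realType) (a b : R) : R := Num.sqrt (a * b).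

Definition harm_mean (R : realType) (a b : R) : R := 2 * a * b / (a + b).

(* The identric mean; [a `^ x] is the real power, so these means are meant for
   positive arguments. *)
Definition identric_mean (R : realType) (a b : R) : R :=
  if a == b then a
  else 1 / expR 1 * (b `^ b / a `^ a) `^ (1 / (b - a)).

(* Main.v *)
Require Import Defs.
From mathcomp Require Import all_boot all_order all_algebra.
From mathcomp Require Import all_classical all_reals all_analysis.
From mathcomp Require Import ring lra.

Set Implicit Arguments.
Unset Strict Implicit.
Unset Printing Implicit Defensive.

Import Order.TTheory GRing.Theory Num.Theory.
Import numFieldNormedType.Exports.

Local Open Scope ring_scope.

(** The logarithm of the identric mean of [a] and [b] is the mean value of [ln]
    on the segment from [a] to [b], while the weighted combination of the
    logarithms of the geometric and arithmetic means is a three-point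
    quadrature rule applied to [ln], interpolating between the trapezoidal rule
    ([2 l = m]) and the midpoint rule ([l = 0]). The quantity to be bounded is
    therefore a quadrature error, and integrating by parts on each half of the
    segment writes it as [(b - a) / 4] times a difference of two integrals of
    [(c - t) / x t] over [0 <= t <= 1], where [c = (m - 2 l) / m] and [x] is an
    affine parametrisation of a half segment ([mean_gapE]).

    Each integral is estimated by the power-mean inequality. The function
    [x `^ (- q)] is convex, so [(x t) `^ (- q)] is at most
    [(1 + t) / 2 * A + (1 - t) / 2 * B] with [A] and [B] the values at the two
    ends; what is left is a moment of [`|t - c| `^ q] against an affine
    function, which is explicit ([moment]). Attaching the factor [`|t - c|] to
    the function gives the first bound, and keeping it as a weight gives the
    second one ([kernel_bounds]). The third bound is the second at exponent 1,
    where the sum over the two halves simplifies.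

    Since every integrand has an explicit primitive, integrals are replaced
    throughout by increments of primitives, and integral inequalities by the
    mean value theorem ([dist_le_of_derive_le], [dist_le_power_mean]): Young's
    inequality with a free parameter bounds the derivative linearly, and the
    parameter is optimised after passing to increments. *)

(** * Identities for real powers *)

Lemma powRV (R : realType) (x r : R) : 0 <= x -> x^-1 `^ r = (x `^ r)^-1.
Proof.
by move=> x0; rewrite -powR_inv1// -powRrM mulrC powRrM powR_inv1 ?powR_ge0.
Qed.

Lemma powRDl1 (R : realType) (x r : R) : 0 <= x -> 0 <= r ->
  x `^ (r + 1) = x * x `^ r.
Proof. by move=> x0 r0; rewrite -(mulr_powRB1 (p := r + 1)) ?addrK//; lra. Qed.

Lemma powRDl2 (R : realType) (x r : R) : 0 <= x -> 0 <= r ->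
  x `^ (r + 2) = x * x * x `^ r.
Proof.
move=> x0 r0; have -> : r + 2 = r + 1 + 1 by ring.
by rewrite !powRDl1 ?mulrA ?addr_ge0.
Qed.

(** * A primitive of a real power of the absolute value *)

(** Multiplying by the sign-carrying factor [x] makes the power differentiable
    at 0 too, because the difference quotient there is [`|x| `^ q] itself.
    Negative points follow from positive ones since the function is odd. *)
Lemma is_derive_powR_odd (R : realType) (q s : R) : 0 < q ->
  is_derive s 1 (fun x : R => x * `|x| `^ q) ((q + 1) * `|s| `^ q).
Proof.
move=> q0.
have pos (x : R) : 0 < x ->
    is_derive x 1 (fun x : R => x * `|x| `^ q) ((q + 1) * `|x| `^ q).
  move=> x0.
  apply: (@near_eq_is_derive _ _ _ (fun x : R => x * x `^ q)).
  - near=> y; congr (_ * (_ `^ q)); rewrite gtr0_norm//.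
    by near: y; apply: lt_nbhsr.
  - have := is_derive1_powR q x0 => dq.
    apply: is_derive_eq.
    rewrite /GRing.scale/= mulr1 gtr0_norm// mulrCA mulr_powRB1 ?(ltW x0)//.
    ring.
case: (ltgtP s 0) => [s0|s0|->]; last 2 first.
- exact: pos.
- rewrite normr0 powR0 ?gt_eqF// mulr0.
  apply/is_derive1_caratheodory; exists (fun x => `|x| `^ q); split.
  + by move=> z; rewrite mul0r !subr0 mulrC.
  (* the ball of radius e ^ (1 / q) suffices *)
  + apply/cvgrPdist_lt => e e0.
    have nb : \forall x \near (0 : R), `|x| < e `^ q^-1.
      by apply: nbhs0_lt; exact: powR_gt0.
    near=> x.
    rewrite normr0 powR0 ?gt_eqF// sub0r normrN ger0_norm ?powR_ge0//.
    have -> : e = (e `^ q^-1) `^ q.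
      by rewrite -powRrM mulVf ?gt_eqF// powRr1 ?ltW.
    rewrite gt0_ltr_powR ?nnegrE ?powR_ge0//.
    by near: x; exact: nb.
  + by rewrite normr0 powR0 ?gt_eqF.
- have Ns0 : 0 < - s by rewrite oppr_gt0.
  have := pos _ Ns0 => dN.
  have dopp (x : R) : is_derive x 1 (-%R : R -> R) (- 1).
    exact: (is_deriveN (is_derive_id x 1)).
  have dC : is_derive s 1 (-%R \o ((fun x : R => x * `|x| `^ q) \o -%R))
     ((- 1) * ((q + 1) * `|- s| `^ q * -1)).
    exact: is_derive1_comp (is_derive1_comp dN (dopp s)).
  rewrite mulrN1 mulN1r opprK normrN in dC.
  apply: near_eq_is_derive dC.
  by near=> y; rewrite /= normrN mulNr opprK.
Unshelve. all: by end_near. Qed.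

Lemma is_derive_shift_powR_odd (R : realType) (c r t : R) : 0 < r ->
  is_derive t 1 (fun x : R => (x - c) * `|x - c| `^ r)
    ((r + 1) * `|t - c| `^ r).
Proof.
move=> r0.
have ds : is_derive t 1 (fun x : R => x - c) 1.
  by apply: is_derive_eq (subr0 _).
have := @is_derive1_comp _ _ (fun x => x - c) _ _ _
  (is_derive_powR_odd (t - c) r0) ds.
by rewrite mulr1.
Qed.

Lemma is_derive_lincomb (R : realType) (k k' x df dg : R) (f g : R -> R) :
  is_derive x 1 f df -> is_derive x 1 g dg ->
  is_derive x 1 (fun y => k * f y + k' * g y) (k * df + k' * dg).
Proof.
move=> Hf Hg; exact: (is_deriveD (is_deriveZ k Hf) (is_deriveZ k' Hg)).
Qed.

(** * The power-mean inequality for increments *)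

(** Integral-free form of the estimate of the integral of [df] by that of
    [`|df|]: both [g + f] and [g - f] are nondecreasing. *)
Lemma dist_le_of_derive_le (R : realType) (f df g dg : R -> R) (a b : R) :
  a <= b ->
  (forall x, x \in `[a, b] -> is_derive x 1 f (df x)) ->
  (forall x, x \in `[a, b] -> is_derive x 1 g (dg x)) ->
  (forall x, x \in `[a, b] -> `|df x| <= dg x) ->
  `|f b - f a| <= g b - g a.
Proof.
move=> ab Hf Hg le_fg.
have step (h dh : R -> R) :
    (forall x, x \in `[a, b] -> is_derive x 1 h (dh x)) ->
    (forall x, x \in `[a, b] -> 0 <= dh x) -> h a <= h b.
  move=> Hh dh0.
  have Ho x : x \in `]a, b[ -> is_derive x 1 h (dh x).
    by move=> /subset_itv_oo_cc; apply: Hh.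
  have [|c cab E] := MVT_segment ab Ho.
    by apply: derivable_within_continuous => x /Hh [].
  by rewrite -subr_ge0 E mulr_ge0 ?dh0 ?subr_ge0.
rewrite ler_norml; apply/andP; split.
- suff : (g \+ f) a <= (g \+ f) b by move=> /=; lra.
  apply: (step _ (fun x => dg x + df x)) => x xab.
    have := Hf _ xab; have := Hg _ xab => ? ?; exact: is_deriveD.
  by have := le_fg _ xab; rewrite ler_norml => /andP[]; lra.
- suff : (g \- f) a <= (g \- f) b by move=> /=; lra.
  apply: (step _ (fun x => dg x - df x)) => x xab.
    have := Hf _ xab; have := Hg _ xab => ? ?; exact: is_deriveB.
  by have := le_fg _ xab; rewrite ler_norml => /andP[]; lra.
Qed.

(** The graph of [v |-> v `^ q] lies above its tangent at [K]; this is Young's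
    inequality for [v / K] and 1. It is stated as a bound linear in [v `^ q]
    so that it can be integrated termwise, [K] being chosen afterwards. *)
Lemma young_powR (R : realType) (q K v : R) : 1 <= q -> 0 < K -> 0 <= v ->
  v <= K `^ (1 - q) * v `^ q / q + (1 - q^-1) * K.
Proof.
move=> q1 K0 v0; have q0 : 0 < q by lra.
have [->|q1'] := eqVneq q 1.
  by rewrite subrr powRr0 powRr1// invr1 subrr; lra.
have {q1'} q1 : 1 < q by rewrite lt_neqAle eq_sym q1'.
have p0 : 0 < 1 - q^-1 by rewrite subr_gt0 invf_lt1.
have vK0 : 0 <= v / K by rewrite divr_ge0// ltW.
have := conjugate_powR vK0 ler01 q0 (q := (1 - q^-1)^-1).
rewrite invr_gt0 invrK subrKC => /(_ p0 erefl).
rewrite mulr1 powR1 mul1r => H.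
have -> : v = K * (v / K) by rewrite mulrCA divff ?mulr1// gt_eqF.
have Kq : K `^ (1 - q) * (K * (v / K)) `^ q = K * (v / K) `^ q.
  rewrite powRM// ?(ltW K0)// mulrA -powRD ?(gt_eqF K0) ?implybT//.
  by rewrite subrK powRr1// ltW.
rewrite Kq.
have -> : K * (v / K) `^ q / q + (1 - q^-1) * K
  = K * ((v / K) `^ q / q + (1 - q^-1)) by ring.
by rewrite ler_pM2l.
Qed.

(** Optimising the bounds that Young's inequality gives: the best parameter is
    the power mean [K = (N / W) `^ q^-1]. *)
Lemma le_power_mean (R : realType) (q D W N : R) : 1 <= q -> 0 < W -> 0 < N ->
  (forall K, 0 < K -> D <= K `^ (1 - q) * N / q + (1 - q^-1) * K * W) ->
  D <= W `^ (1 - q^-1) * N `^ q^-1.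
Proof.
move=> q1 W0 N0 H; have q0 : 0 < q by lra.
have NW : 0 < N / W by rewrite divr_gt0.
apply: (le_trans (H ((N / W) `^ q^-1) (powR_gt0 _ NW))).
have E : W `^ (1 - q^-1) * N `^ q^-1 = (N / W) `^ q^-1 * W.
  rewrite powRB ?(gt_eqF W0) ?implybT// powRr1 ?ltW// powRM ?invr_ge0 ?ltW//.
  by rewrite powRV ?ltW//; ring.
have -> : (N / W) `^ q^-1 `^ (1 - q) * N = (N / W) `^ q^-1 * W.
  rewrite -powRrM mulrBr mulr1 mulVf ?gt_eqF//.
  rewrite powRB ?(gt_eqF NW) ?implybT// powRr1 ?ltW//.
  by field; rewrite !gt_eqF.
rewrite E le_eqVlt; apply/orP; left; apply/eqP; field.
by rewrite gt_eqF.
Qed.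

(** The weighted power-mean inequality, the integral of [dw * v] being at most
    [(integral of dw) ^ (1 - 1/q) * (integral of dw * v ^ q) ^ (1/q)], with
    every integral replaced by the increment of a primitive. Young's inequality
    at a fixed [K] is linear in the integrands, so it passes to increments by
    monotonicity. *)
Lemma dist_le_power_mean (R : realType) (q a b : R)
    (f df w dw n dn v : R -> R) :
  1 <= q -> a <= b ->
  (forall x, x \in `[a, b] -> is_derive x 1 f (df x)) ->
  (forall x, x \in `[a, b] -> is_derive x 1 w (dw x)) ->
  (forall x, x \in `[a, b] -> is_derive x 1 n (dn x)) ->
  (forall x, x \in `[a, b] -> [/\ 0 <= v x, 0 <= dw x,
     `|df x| = dw x * v x & dw x * v x `^ q <= dn x]) ->
  0 < w b - w a -> 0 < n b - n a ->
  `|f b - f a| <= (w b - w a) `^ (1 - q^-1) * (n b - n a) `^ q^-1.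
Proof.
move=> q1 ab Hf Hw Hn Hv W0 N0; have q0 : 0 < q by lra.
apply: le_power_mean => // K K0.
set k := K `^ (1 - q) / q; set k' := (1 - q^-1) * K.
pose g (x : R) := k * n x + k' * w x.
have -> : K `^ (1 - q) * (n b - n a) / q + k' * (w b - w a) = g b - g a.
  by rewrite /g /k; ring.
apply: (@dist_le_of_derive_le R f df g
  (fun x => k * dn x + k' * dw x) a b) => //.
  by move=> x xab; apply: is_derive_lincomb; [exact: Hn|exact: Hw].
move=> x /Hv[v0 w0 -> vn].
have k0 : 0 <= k by rewrite divr_ge0 ?powR_ge0 ?ltW.
have Y := young_powR q1 K0 v0.
apply: (le_trans (ler_wpM2l w0 Y)).
rewrite mulrDr [dw x * k']mulrC lerD2r.
have -> : dw x * (K `^ (1 - q) * v x `^ q / q) = k * (dw x * v x `^ q).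
  by rewrite /k; ring.
exact: ler_wpM2l.
Qed.

(** * Moments of the Peano kernel *)

(** The integral of [`|t - c| `^ r * ((1 + t) / 2 * A + (1 - t) / 2 * B)] over
    [0 <= t <= 1], in closed form. *)
Definition moment (R : realType) (c r A B : R) : R :=
  (((r + 2 + c) * c `^ (r + 1) + (2 * r + 3 + c) * (1 - c) `^ (r + 1)) * A
   + ((1 - c) `^ (r + 2) + (r + 2 - c) * c `^ (r + 1)) * B)
  / (2 * (r + 1) * (r + 2)).

(** Obtained by writing the affine factor of the integrand in powers of
    [t - c]. *)
Definition moment_primitive (R : realType) (c r A B t : R) : R :=
  ((1 + c) * A + (1 - c) * B) / (2 * (r + 1)) * ((t - c) * `|t - c| `^ r)
  + (A - B) / (2 * (r + 2)) * ((t - c) * ((t - c) * `|t - c| `^ r)).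

Lemma is_derive_moment_primitive (R : realType) (c r A B t : R) : 0 < r ->
  is_derive t 1 (moment_primitive c r A B)
    (`|t - c| `^ r * ((1 + t) / 2 * A + (1 - t) / 2 * B)).
Proof.
move=> r0; rewrite /moment_primitive.
have dP := is_derive_shift_powR_odd c t r0.
have ds : is_derive t 1 (fun x : R => x - c) 1.
  by apply: is_derive_eq (subr0 _).
set k := _ / _; set k' := (A - B) / _.
pose P (x : R) := (x - c) * `|x - c| `^ r.
have dk : is_derive t 1 (k *: P + k' *: ((fun x : R => x - c) * P))
  (k *: ((r + 1) * `|t - c| `^ r)
    + k' *: ((t - c) *: ((r + 1) * `|t - c| `^ r) + P t *: 1)).
  exact: (is_deriveD (is_deriveZ k dP) (is_deriveZ k' (is_deriveM ds dP))).
apply: (is_derive_eq dk).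
rewrite /k /k' /P /GRing.scale/=; field.
by rewrite !gt_eqF; lra.
Qed.

Lemma moment_primitiveE (R : realType) (c r A B : R) :
  0 <= c <= 1 -> 0 < r ->
  moment_primitive c r A B 1 - moment_primitive c r A B 0 = moment c r A B.
Proof.
move=> /andP[c0 c1] r0; rewrite /moment_primitive /moment sub0r normrN.
rewrite !ger0_norm ?subr_ge0// powRDl2 ?powRDl1 ?subr_ge0// ?ltW//.
by field; rewrite !gt_eqF; lra.
Qed.

Lemma moment_gt0 (R : realType) (c r A B : R) :
  0 <= c <= 1 -> 0 < r -> 0 < A -> 0 < B -> 0 < moment c r A B.
Proof.
move=> /andP[c0 c1] r0 A0 B0; rewrite divr_gt0//; last first.
  by rewrite !mulr_gt0; lra.
rewrite ltr_wpDr//.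
  by rewrite mulr_ge0 ?(ltW B0)// addr_ge0 ?powR_ge0// mulr_ge0 ?powR_ge0; lra.
rewrite mulr_gt0//.
(* c and 1 - c cannot both vanish *)
have [c_gt0|c_le0] := ltP 0 c.
  by rewrite ltr_wpDr// ?mulr_ge0 ?mulr_gt0 ?powR_ge0 ?powR_gt0//; lra.
by rewrite ltr_wpDl// ?mulr_ge0 ?mulr_gt0 ?powR_ge0 ?powR_gt0//; lra.
Qed.

(** The two bounds come from the two ways of splitting [`|c - t| * v t]: weight
    1 and function [`|t - c| * v t], or weight [`|t - c|] and function [v t].
    [A] and [B] play the role of the values of [v `^ q] at the two ends of the
    full segment, of which [0 <= t <= 1] parametrises one half. *)
Lemma kernel_bounds (R : realType) (c q A B : R) (f v : R -> R) :
  0 <= c <= 1 -> 1 <= q -> 0 < A -> 0 < B ->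
  (forall t : R, t \in `[0, 1] -> is_derive t 1 f ((c - t) * v t)) ->
  (forall t : R, t \in `[0, 1] ->
     0 <= v t /\ v t `^ q <= (1 + t) / 2 * A + (1 - t) / 2 * B) ->
  `|f 1 - f 0| <= moment c q A B `^ q^-1 /\
  `|f 1 - f 0| <=
    ((c ^+ 2 + (1 - c) ^+ 2) / 2) `^ (1 - q^-1) * moment c 1 A B `^ q^-1.
Proof.
move=> c01 q1 A0 B0 Hf Hv; have q0 : 0 < q by lra.
have /andP[c0 c1] := c01.
split.
- rewrite -moment_primitiveE//.
  have bound := @dist_le_power_mean R q 0 1 f (fun t : R => (c - t) * v t)
    (fun t => t) (fun=> 1) (moment_primitive c q A B)
    (fun t => `|t - c| `^ q * ((1 + t) / 2 * A + (1 - t) / 2 * B))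
    (fun t => `|t - c| * v t) q1 ler01 Hf.
  rewrite subr0 powR1 mul1r in bound; apply: bound.
  + by move=> x _; exact: is_derive_moment_primitive.
  + move=> x /Hv[v0 vq]; split => //.
    * exact: mulr_ge0.
    * by rewrite normrM mul1r distrC (ger0_norm v0).
    * by rewrite mul1r powRM// ler_wpM2l ?powR_ge0.
  + exact: ltr01.
  + by rewrite moment_primitiveE// moment_gt0.
- pose w (t : R) := 2^-1 * ((t - c) * `|t - c| `^ 1).
  have wE : w 1 - w 0 = (c ^+ 2 + (1 - c) ^+ 2) / 2.
    rewrite /w sub0r normrN !ger0_norm ?subr_ge0// !powRr1 ?subr_ge0//.
    by field.
  rewrite -moment_primitiveE// -wE.
  apply: (@dist_le_power_mean R q 0 1 f (fun t : R => (c - t) * v t)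
    w (fun t => `|t - c|) (moment_primitive c 1 A B)
    (fun t => `|t - c| `^ 1 * ((1 + t) / 2 * A + (1 - t) / 2 * B))
    v q1 ler01 Hf).
  + move=> x _; have dP := is_derive_shift_powR_odd c x (@ltr01 R).
    have dw : is_derive x 1 (2^-1 *: (fun x : R => (x - c) * `|x - c| `^ 1))
        (2^-1 *: ((1 + 1) * `|x - c| `^ 1)).
      exact: is_deriveZ.
    apply: (is_derive_eq dw).
    by rewrite powRr1// /GRing.scale/=; field.
  + by move=> x _; exact: is_derive_moment_primitive.
  + move=> x /Hv[v0 vq]; split => //.
    * by rewrite normrM distrC (ger0_norm v0).
    * by rewrite powRr1// ler_wpM2l.
  + rewrite wE.
    have -> : (c ^+ 2 + (1 - c) ^+ 2) / 2 = (2 * c - 1) ^+ 2 / 4 + 4^-1.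
      by field.
    by rewrite ltr_wpDl ?invr_gt0 ?divr_ge0 ?sqr_ge0.
  + by rewrite moment_primitiveE// moment_gt0.
Qed.

(** * The Peano kernel for the logarithm *)

Lemma convex_comb_gt0 (R : realType) (s x y : R) :
  0 <= s <= 1 -> 0 < x -> 0 < y -> 0 < s * x + (1 - s) * y.
Proof.
move=> /andP[s0 s1] x0 y0; have t0 : 0 <= 1 - s by rewrite subr_ge0.
have [s_gt0|s_le0] := ltP 0 s.
  by apply: ltr_pwDl; [exact: mulr_gt0|apply: mulr_ge0 => //; exact: ltW].
apply: ltr_wpDl; first by apply: mulr_ge0 => //; exact: ltW.
by apply: mulr_gt0 => //; lra.
Qed.

(** Convexity of [x |-> x `^ (- q)], as the convex nondecreasing power [q] of
    the convex function [x^-1]. *)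
Lemma powR_inv_convex (R : realType) (q s x y : R) :
  1 <= q -> 0 <= s <= 1 -> 0 < x -> 0 < y ->
  (s * x + (1 - s) * y)^-1 `^ q <= s / x `^ q + (1 - s) / y `^ q.
Proof.
move=> q1 /andP[s0 s1] x0 y0.
have z0 : 0 < s * x + (1 - s) * y by apply: convex_comb_gt0; rewrite ?s0.
(* the weighted harmonic mean is at most the arithmetic one *)
have cv : (s * x + (1 - s) * y)^-1 <= s * x^-1 + (1 - s) * y^-1.
  rewrite -subr_ge0.
  have -> : s * x^-1 + (1 - s) * y^-1 - (s * x + (1 - s) * y)^-1 =
     s * (1 - s) * (x - y) ^+ 2 / (x * y * (s * x + (1 - s) * y)).
    by field; rewrite !gt_eqF.
  apply: divr_ge0; last by rewrite ltW// mulr_gt0// mulr_gt0.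
  by apply: mulr_ge0; [rewrite mulr_ge0// subr_ge0|exact: sqr_ge0].
have xV : 0 <= x^-1 by rewrite invr_ge0 ltW.
have yV : 0 <= y^-1 by rewrite invr_ge0 ltW.
apply: (@le_trans _ _ ((s * x^-1 + (1 - s) * y^-1) `^ q)).
  rewrite ge0_ler_powR ?nnegrE ?invr_ge0 ?(ltW z0)//; first lra.
  by rewrite addr_ge0// mulr_ge0// subr_ge0.
rewrite -!powRV ?(ltW x0) ?(ltW y0)//.
have := @convex_powR R q q1 (Itv01 s0 s1) x^-1 y^-1.
rewrite !inE/= !in_itv/= !andbT => /(_ xV yV); exact.
Qed.

(** The integral of [(c - t) / x t] over [0 <= t <= 1], where [x] runs affinely
    from the midpoint of [e] and [d] at [t = 0] to [e] at [t = 1]. Exchanging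
    [e] and [d] gives the other half of the segment, so one estimate serves
    for both. *)
Definition log_kernel (R : realType) (c e d : R) : R :=
  ((1 - c) * ln e + c * ln ((e + d) / 2)) / ((d - e) / 2)
  + ((e * ln e - e) - ((e + d) / 2 * ln ((e + d) / 2) - (e + d) / 2))
    / ((d - e) / 2) ^+ 2.

Lemma log_kernel_bounds (R : realType) (c q e d : R) :
  0 <= c <= 1 -> 1 <= q -> 0 < e -> 0 < d -> e != d ->
  `|log_kernel c e d| <= moment c q (e `^ q)^-1 (d `^ q)^-1 `^ q^-1 /\
  `|log_kernel c e d| <= ((c ^+ 2 + (1 - c) ^+ 2) / 2) `^ (1 - q^-1)
     * moment c 1 (e `^ q)^-1 (d `^ q)^-1 `^ q^-1.
Proof.
move=> c01 q1 e0 d0 ed.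
pose h := (d - e) / 2; pose x (t : R) := (e + d) / 2 - h * t.
have h0 : h != 0.
  by apply: mulf_neq0; [rewrite subr_eq0 eq_sym|rewrite invr_eq0 pnatr_eq0].
(* integration by parts: a primitive of (c - t) / x t *)
pose f (t : R) := (t - c) / h * ln (x t) + (x t * ln (x t) - x t) / h ^+ 2.
have xE t : x t = (1 + t) / 2 * e + (1 - (1 + t) / 2) * d.
  by rewrite /x /h; field.
have x0 t : t \in `[0, 1] -> 0 < x t.
  rewrite in_itv/= => /andP[t0 t1]; rewrite xE.
  by apply: convex_comb_gt0 => //; lra.
have -> : log_kernel c e d = f 1 - f 0.
  have x1 : x 1 = e by rewrite /x /h; field.
  have x00 : x 0 = (e + d) / 2 by rewrite /x; ring.
  by rewrite /f x1 x00 /log_kernel -/h; field.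
apply: (@kernel_bounds R c q (e `^ q)^-1 (d `^ q)^-1 f
  (fun t => (x t)^-1)) => //.
- by rewrite invr_gt0 powR_gt0.
- by rewrite invr_gt0 powR_gt0.
- move=> t t01; have xt0 := x0 _ t01.
  have dx : is_derive t 1 x (- h).
    have dx' : is_derive t 1 (cst ((e + d) / 2) - h *: (fun t : R => t))
        (0 - h *: 1).
      by apply: is_deriveB.
    by apply: (is_derive_eq dx'); rewrite sub0r /GRing.scale/= mulr1.
  have dl : is_derive t 1 (fun t => ln (x t)) ((x t)^-1 * - h).
    have := is_derive1_ln xt0 => ?; exact: is_derive1_comp.
  have ds : is_derive t 1 (fun t : R => t - c) 1.
    by apply: is_derive_eq (subr0 _).
  have df := is_derive_lincomb h^-1 (h ^+ 2)^-1 (is_deriveM ds dl)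
    (is_deriveB (is_deriveM dx dl) dx).
  have -> : f = (fun u => h^-1 * ((u - c) * ln (x u))
      + (h ^+ 2)^-1 * (x u * ln (x u) - x u)).
    by apply/funext => u; rewrite /f; field.
  apply: (is_derive_eq df); rewrite /GRing.scale/=; field.
  by rewrite h0 gt_eqF.
- move=> t t01; have xt0 := x0 _ t01; split; first by rewrite invr_ge0 ltW.
  rewrite xE; have -> : (1 - t) / 2 = 1 - (1 + t) / 2 by field.
  apply: powR_inv_convex => //.
  by move: t01; rewrite in_itv/=; lra.
Qed.

(** * The gap between the means, and its rescaling *)

Lemma ln_identric_mean (R : realType) (a b : R) : 0 < a -> 0 < b -> a != b ->
  ln (identric_mean a b) = (b * ln b - a * ln a) / (b - a) - 1.
Proof.
move=> a0 b0 ab; rewrite /identric_mean (negPf ab) div1r -expRN.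
have pos : 0 < b `^ b / a `^ a by rewrite divr_gt0 ?powR_gt0.
rewrite lnM ?posrE ?expR_gt0 ?powR_gt0// expRK ln_powR.
rewrite ln_div ?posrE ?powR_gt0// !ln_powR.
by ring.
Qed.

Lemma ln_geom_mean (R : realType) (a b : R) : 0 < a -> 0 < b ->
  ln (geom_mean a b) = (ln a + ln b) / 2.
Proof.
move=> a0 b0; rewrite /geom_mean -powR12_sqrt ?mulr_ge0 ?ltW//.
by rewrite ln_powR lnM ?posrE// mulrC.
Qed.

(** With [c = 1 - 2 l / m] the left side is the error of the quadrature rule of
    weights [l / m], [c], [l / m] at [a], the midpoint and [b] for the mean
    value of [ln] on the segment, since that mean value is [ln] of the identric
    mean. The right side is Peano's form of this error, one kernel per half
    segment. *)
Lemma mean_gapE (R : realType) (a b m l : R) :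
  0 < a -> 0 < b -> a != b -> m != 0 ->
  (2 * l * ln (geom_mean a b) + (m - 2 * l) * ln (arith_mean a b)) / m
    - ln (identric_mean a b) =
  (b - a) / 4 * (log_kernel ((m - 2 * l) / m) a b
                 - log_kernel ((m - 2 * l) / m) b a).
Proof.
move=> a0 b0 ab m0.
rewrite ln_identric_mean// ln_geom_mean// /arith_mean /log_kernel [b + a]addrC.
by field; rewrite m0 !subr_eq0 ab eq_sym ab.
Qed.

(** Clears the denominator [m] of [c = (m - 2 l) / m]: the numerator is
    homogeneous of degree [r + 2] in [(m, l)]. The factor [m `^ r] is kept
    apart because its [r]-th root comes out of the final bound. *)
Lemma moment_scale (R : realType) (m l r A B : R) :
  0 < m -> 0 <= 2 * l <= m -> 0 < r ->
  moment ((m - 2 * l) / m) r A B =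
  (((m * r + 3 * m - 2 * l) * (m - 2 * l) `^ (r + 1)
    + (2 * m * r + 4 * m - 2 * l) * (2 * l) `^ (r + 1)) * A
   + ((2 * l) `^ (r + 2)
      + (m * r + m + 2 * l) * (m - 2 * l) `^ (r + 1)) * B)
  * (1 / (2 * m ^+ 2 * (r + 1) * (r + 2))) / m `^ r.
Proof.
move=> m0 /andP[l0 lm] r0.
have mV : 0 <= m^-1 by rewrite invr_ge0 ltW.
have c0 : 0 <= m - 2 * l by rewrite subr_ge0.
have lE : 1 - (m - 2 * l) / m = 2 * l / m by field; rewrite gt_eqF.
rewrite /moment lE !powRDl2 ?powRDl1 ?divr_ge0 ?(ltW m0) ?(ltW r0)//.
have divE x : 0 <= x -> (x / m) `^ r = x `^ r / m `^ r.
  by move=> x0; rewrite powRM// powRV ?(ltW m0).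
rewrite !divE//.
by field; rewrite gt_eqF ?powR_gt0// !gt_eqF//; lra.
Qed.

Lemma moment1_scale (R : realType) (m l A B : R) :
  0 < m -> 0 <= 2 * l <= m ->
  moment ((m - 2 * l) / m) 1 A B =
  ((4 * (3 * m - l) * l ^+ 2 + (2 * m - l) * (m - 2 * l) ^+ 2) * A
   + (4 * l ^+ 3 + (m + l) * (m - 2 * l) ^+ 2) * B)
  * (1 / (3 * m)) / (2 * m ^+ 2).
Proof.
move=> m0 /andP[l0 lm]; rewrite moment_scale ?l0//.
rewrite !powRDl2 ?powRDl1 ?subr_ge0// !powRr1 ?subr_ge0 ?(ltW m0)//.
by field; rewrite gt_eqF.
Qed.

Lemma powR_root_scale (R : realType) (q x y m : R) :
  0 < q -> 0 <= x -> 0 <= y -> 0 < m ->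
  (x * y / m `^ q) `^ q^-1 = x `^ q^-1 * y `^ q^-1 / m.
Proof.
move=> q0 x0 y0 m0; rewrite !powRM ?mulr_ge0 ?invr_ge0 ?powR_ge0//.
by rewrite powRV ?powR_ge0// -powRrM mulfV ?gt_eqF// powRr1 ?ltW.
Qed.

(** The exponents of the common factor [k^-1] add up to 1. *)
Lemma powR_weights_scale (R : realType) (s x y z k : R) :
  0 <= x -> 0 <= y -> 0 <= z -> 0 < k ->
  (x / k) `^ (1 - s) * (y * z / k) `^ s = z `^ s * x `^ (1 - s) * y `^ s / k.
Proof.
move=> x0 y0 z0 k0.
have kV : 0 < k^-1 by rewrite invr_gt0.
have kE : k^-1 `^ (1 - s) * k^-1 `^ s = k^-1.
  by rewrite -powRD ?(gt_eqF kV) ?implybT// subrK powRr1// ltW.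
by rewrite !powRM ?mulr_ge0 ?(ltW kV)// -[in RHS]kE; ring.
Qed.

Lemma moment_root (R : realType) (m l q A B : R) :
  0 < m -> 0 <= 2 * l <= m -> 0 < q -> 0 <= A -> 0 <= B ->
  moment ((m - 2 * l) / m) q A B `^ q^-1 =
  (((m * q + 3 * m - 2 * l) * (m - 2 * l) `^ (q + 1)
    + (2 * m * q + 4 * m - 2 * l) * (2 * l) `^ (q + 1)) * A
   + ((2 * l) `^ (q + 2)
      + (m * q + m + 2 * l) * (m - 2 * l) `^ (q + 1)) * B) `^ q^-1
  * (1 / (2 * m ^+ 2 * (q + 1) * (q + 2))) `^ q^-1 / m.
Proof.
move=> m0 lm q0 A0 B0; rewrite moment_scale//.
have mq0 : 0 <= m * q by rewrite mulr_ge0 ?ltW.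
have /andP[l0 lm'] := lm.
have k1 : 0 <= m * q + 3 * m - 2 * l by lra.
have k2 : 0 <= 2 * m * q + 4 * m - 2 * l by lra.
have k3 : 0 <= m * q + m + 2 * l by lra.
have k4 : 0 <= 2 * m ^+ 2 * (q + 1) * (q + 2).
  by rewrite !mulr_ge0 ?sqr_ge0//; lra.
apply: powR_root_scale => //; last by rewrite divr_ge0.
by apply: addr_ge0; apply: mulr_ge0 => //; apply: addr_ge0;
  rewrite ?mulr_ge0 ?powR_ge0.
Qed.

Lemma moment1_weighted_root (R : realType) (m l s A B : R) :
  0 < m -> 0 <= 2 * l <= m -> 0 <= A -> 0 <= B ->
  ((((m - 2 * l) / m) ^+ 2 + (1 - (m - 2 * l) / m) ^+ 2) / 2) `^ (1 - s)
  * moment ((m - 2 * l) / m) 1 A B `^ s =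
  (1 / (3 * m)) `^ s * ((m - 2 * l) ^+ 2 + (2 * l) ^+ 2) `^ (1 - s)
  * ((4 * (3 * m - l) * l ^+ 2 + (2 * m - l) * (m - 2 * l) ^+ 2) * A
     + (4 * l ^+ 3 + (m + l) * (m - 2 * l) ^+ 2) * B) `^ s / (2 * m ^+ 2).
Proof.
move=> m0 lm A0 B0; rewrite moment1_scale//.
have -> : (((m - 2 * l) / m) ^+ 2 + (1 - (m - 2 * l) / m) ^+ 2) / 2 =
    ((m - 2 * l) ^+ 2 + (2 * l) ^+ 2) / (2 * m ^+ 2).
  by field; rewrite gt_eqF.
have /andP[l0 lm'] := lm.
have l1 : 0 <= l by lra.
have k1 : 0 <= 4 * (3 * m - l) by lra.
have k2 : 0 <= 2 * m - l by lra.
have k3 : 0 <= m + l by lra.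
apply: powR_weights_scale.
- by rewrite addr_ge0 ?sqr_ge0.
- apply: addr_ge0; apply: mulr_ge0 => //; apply: addr_ge0; apply: mulr_ge0;
    by rewrite ?sqr_ge0 ?exprn_ge0.
- by rewrite divr_ge0 ?mulr_ge0 ?ltW.
- by rewrite mulr_gt0 ?exprn_gt0.
Qed.

Theorem theorem4p4 (R : realType) (a b q m l : R)
    (ha : 0 < a) (hab : a < b) (hq : 1 <= q)
    (hm : 0 < m) (hml : 2 * l <= m) (hl : 0 <= 2 * l) :
  [/\ `| (2 * l * ln (geom_mean a b) + (m - 2 * l) * ln (arith_mean a b)) / m
         - ln (identric_mean a b) |
      <= (b - a) / (4 * m)
         * (1 / (2 * m ^+ 2 * (q + 1) * (q + 2))) `^ (1 / q)
         * ((((2 * l) `^ (q + 2)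
                + (m * q + m + 2 * l) * (m - 2 * l) `^ (q + 1)) / a `^ q
             + ((m * q + 3 * m - 2 * l) * (m - 2 * l) `^ (q + 1)
                + (2 * m * q + 4 * m - 2 * l) * (2 * l) `^ (q + 1)) / b `^ q)
              `^ (1 / q)
            + (((2 * m * q + 4 * m - 2 * l) * (2 * l) `^ (q + 1)
                + (m * q + 3 * m - 2 * l) * (m - 2 * l) `^ (q + 1)) / a `^ q
             + ((2 * l) `^ (q + 2)
                + (m * q + m + 2 * l) * (m - 2 * l) `^ (q + 1)) / b `^ q)
              `^ (1 / q)),
      `| (2 * l * ln (geom_mean a b) + (m - 2 * l) * ln (arith_mean a b)) / m
         - ln (identric_mean a b) |
      <= (b - a) / (8 * m ^+ 2)
         * (1 / (3 * m)) `^ (1 / q)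
         * ((m - 2 * l) ^+ 2 + (2 * l) ^+ 2) `^ (1 - 1 / q)
         * (((4 * l ^+ 3 + (m + l) * (m - 2 * l) ^+ 2) / a `^ q
             + ((2 * m - l) * (m - 2 * l) ^+ 2
                + 4 * (3 * m - l) * l ^+ 2) / b `^ q) `^ (1 / q)
            + ((4 * (3 * m - l) * l ^+ 2
                + (2 * m - l) * (m - 2 * l) ^+ 2) / a `^ q
             + (4 * l ^+ 3 + (m + l) * (m - 2 * l) ^+ 2) / b `^ q) `^ (1 / q))
    & `| (2 * l * ln (geom_mean a b) + (m - 2 * l) * ln (arith_mean a b)) / m
         - ln (identric_mean a b) |
      <= (b - a) / (4 * m ^+ 2)
         * ((4 * l ^+ 2 + (m - 2 * l) ^+ 2) / harm_mean a b)].
Proof.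
have b0 : 0 < b by lra.
have q0 : 0 < q by lra.
have ab : a != b by rewrite lt_eqF.
have ba : b != a by rewrite gt_eqF.
have m_neq0 : m != 0 by rewrite gt_eqF.
have lm : 0 <= 2 * l <= m by rewrite hl hml.
have Aq r : 0 <= (a `^ r)^-1 by rewrite invr_ge0 powR_ge0.
have Bq r : 0 <= (b `^ r)^-1 by rewrite invr_ge0 powR_ge0.
have c01 : 0 <= (m - 2 * l) / m <= 1.
  rewrite divr_ge0 ?subr_ge0 ?(ltW hm)//= ler_pdivrMr// mul1r; lra.
rewrite mean_gapE//.
set D := `|_|.
(* the three bounds differ only in the estimate used on each half segment *)
have bd X Y Z : `|log_kernel ((m - 2 * l) / m) a b| <= X ->
    `|log_kernel ((m - 2 * l) / m) b a| <= Y ->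
    (b - a) / 4 * (Y + X) = Z -> D <= Z.
  move=> hX hY <-; rewrite /D normrM ger0_norm; last by rewrite divr_ge0//; lra.
  rewrite ler_wpM2l ?divr_ge0//; first lra.
  by rewrite (le_trans (ler_normB _ _))// addrC lerD.
clearbody D.
have KA := log_kernel_bounds c01 _ ha b0 ab.
have KB := log_kernel_bounds c01 _ b0 ha ba.
split.
- have [KA1 _] := KA _ hq; have [KB1 _] := KB _ hq.
  apply: (bd _ _ _ KA1 KB1); clear bd KA KB KA1 KB1.
  rewrite !moment_root// [1 / q]div1r.
  rewrite [_ / b `^ q + _]addrC [(2 * m * q + _ - _) * _ + _]addrC -!mulrDl.
  have factor u k : (b - a) / 4 * (u * k / m) = (b - a) / (4 * m) * k * u.
    by field.
  exact: factor.
- have [_] := KA _ hq; rewrite (moment1_weighted_root q^-1)// => KA2.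
  have [_] := KB _ hq; rewrite (moment1_weighted_root q^-1)// => KB2.
  apply: (bd _ _ _ KA2 KB2); clear bd KA KB KA2 KB2.
  rewrite [1 / q]div1r.
  rewrite [_ / b `^ q + _]addrC [(2 * m - l) * _ + _]addrC -mulrDl -mulrDr.
  have factor u k k' : (b - a) / 4 * (k * k' * u / (2 * m ^+ 2)) =
      (b - a) / (8 * m ^+ 2) * k * k' * u by field.
  exact: factor.
(* at exponent 1 the second estimate is linear, and 1/H = (1/a + 1/b) / 2 *)
- have [_ KA1] := KA _ (lexx 1); have [_ KB1] := KB _ (lexx 1).
  apply: (bd _ _ _ KA1 KB1); clear bd KA KB KA1 KB1.
  rewrite invr1 (subrr (1 : R)) powRr0 /harm_mean.
  rewrite !powRr1 ?(ltW (moment_gt0 _ _ _ _)) ?invr_gt0 ?(ltW ha) ?(ltW b0)//.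
  rewrite !moment1_scale//; field.
  by rewrite !gt_eqF//; lra.
Qed.
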